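(* Let $T\in(0,\infty)$ and let $(E,d)$ be a metric space. Suppose that $\delta\in(0,1)$ and $p\in(1,\infty)$ are such that $\delta>1/p$. Then $\|\cdot\|_{V^{\delta,p}}$, $\|\cdot\|_{\tilde V^{\delta,p}}$ and $\|\cdot\|_{\hat N^{\delta,p}}$ are equivalent, that is, there are constants $C_1,C_2,C_3>0$ such that for every continuous function $f:[0,T]\to E$ $$\|f\|_{V^{\delta,p}}\le C_1\|f\|_{\tilde V^{\delta,p}},\qquad \|f\|_{\tilde V^{\delta,p}}\le C_2\|f\|_{\hat N^{\delta,p}},\qquad \|f\|_{\hat N^{\delta,p}}\le C_3\|f\|_{V^{\delta,p}}$$ (as inequalities in $[0,\infty]$), and thus $$V^{\delta,p}([0,T];E)=\tilde V^{\delta,p}([0,T];E)=\hat N^{\delta,p}([0,T];E).$$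
   Context: $\mathcal{P}\subset[s,t]$ means $\mathcal{P}=\{[t_i,t_{i+1}]: s=t_0<t_1<\dots<t_M=t\}$ is a finite partition of $[s,t]$. For a continuous $f:[0,T]\to E$ and $[s,t]\subset[0,T]$, put $\|f\|_{r\text{-var};[s,t]}=\big(\sup_{\mathcal{P}\subset[s,t]}\sum_{[u,v]\in\mathcal{P}}d(f_u,f_v)^r\big)^{1/r}$, $\|f\|_{V^{\delta,p};[s,t]}=\big(\sup_{\mathcal{P}\subset[s,t]}\sum_{[u,v]\in\mathcal{P}}\frac{d(f_u,f_v)^p}{|v-u|^{\delta p-1}}\big)^{1/p}$, $\|f\|_{\tilde V^{\delta,p};[s,t]}=\big(\sup_{\mathcal{P}\subset[s,t]}\sum_{[u,v]\in\mathcal{P}}\frac{\|f\|_{1/\delta\text{-var};[u,v]}^p}{|v-u|^{\delta p-1}}\big)^{1/p}$, $\|f\|_{N^{\delta,p};[s,t]}=\sup_{0<h\le t-s}h^{-\delta}\big(\int_s^{t-h}d(f_u,f_{u+h})^p\,du\big)^{1/p}$, $\|f\|_{\hat N^{\delta,p};[s,t]}=\big(\sup_{\mathcal{P}\subset[s,t]}\sum_{[u,v]\in\mathcal{P}}\|f\|_{N^{\delta,p};[u,v]}^p\big)^{1/p}$. The interval is omitted from the notation when it is $[0,T]$. $V^{\delta,p}([0,T];E)$, $\tilde V^{\delta,p}([0,T];E)$, $\hat N^{\delta,p}([0,T];E)$ are the sets of continuous $f:[0,T]\to E$ for which the corresponding quantity on $[0,T]$ is finite. *)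

(* Defs.v *)
From mathcomp Require Import all_boot all_order all_algebra.
From mathcomp Require Import all_classical all_reals all_analysis.

Set Implicit Arguments.
Unset Strict Implicit.
Unset Printing Implicit Defensive.

Import Order.TTheory GRing.Theory Num.Theory.
Import numFieldNormedType.Exports.

Local Open Scope classical_set_scope.
Local Open Scope ring_scope.
Local Open Scope ereal_scope.

(* A function [0, T] -> E is represented by a total function R -> E that is
   only required to be continuous within [0, T]. The quantities below, taken
   on [s, t], only depend on the restriction of the function to [s, t]. *)

(* In [itv_partition s t P] the left endpoint s is not listed in P: the
   partition is s :: P, and its intervals [u, v] are the consecutive pairs. *)
Definition partition_sup (R : realType) (F : R -> R -> \bar R) (s t : R) :
    \bar R :=
  ereal_sup [set \sum_(uv <- zip (s :: P) P) F uv.1 uv.2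
            | P in itv_partition s t].

Definition var_norm (R : realType) (E : metricType R) (r : R) (f : R -> E)
    (s t : R) : \bar R :=
  (partition_sup (fun u v => (mdist (f u) (f v) `^ r)%:E) s t) `^ r^-1.

Definition V_norm (R : realType) (E : metricType R) (delta p : R) (f : R -> E)
    (s t : R) : \bar R :=
  (partition_sup (fun u v =>
    (mdist (f u) (f v) `^ p / `|v - u| `^ (delta * p - 1))%:E) s t) `^ p^-1.

Definition Vtilde_norm (R : realType) (E : metricType R) (delta p : R)
    (f : R -> E) (s t : R) : \bar R :=
  (partition_sup (fun u v =>
    var_norm delta^-1 f u v `^ p * ((`|v - u| `^ (delta * p - 1))^-1)%:E)
    s t) `^ p^-1.

(* Only meaningful for s < t: otherwise the supremum is over the empty set. *)
Definition N_norm (R : realType) (E : metricType R) (delta p : R) (f : R -> E)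
    (s t : R) : \bar R :=
  ereal_sup [set (h `^ (- delta))%:E *
      (\int[lebesgue_measure]_(u in `[s, (t - h)%R])
        (mdist (f u) (f (u + h)%R) `^ p)%:E) `^ p^-1
    | h in `]0%R, (t - s)%R]].

Definition Nhat_norm (R : realType) (E : metricType R) (delta p : R)
    (f : R -> E) (s t : R) : \bar R :=
  (partition_sup (fun u v => N_norm delta p f u v `^ p) s t) `^ p^-1.

Definition V_space (R : realType) (E : metricType R) (delta p T : R) :
    set (R -> E) :=
  [set f | {within `[0%R, T], continuous f} /\ V_norm delta p f 0 T < +oo].

Definition Vtilde_space (R : realType) (E : metricType R) (delta p T : R) :
    set (R -> E) :=
  [set f | {within `[0%R, T], continuous f} /\ Vtilde_norm delta p f 0 T < +oo].

Definition Nhat_space (R : realType) (E : metricType R) (delta p T : R) :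
    set (R -> E) :=
  [set f | {within `[0%R, T], continuous f} /\ Nhat_norm delta p f 0 T < +oo].

Arguments V_space {R} E delta p T _.
Arguments Vtilde_space {R} E delta p T _.
Arguments Nhat_space {R} E delta p T _.

(* Main.v *)
Require Import Defs.
From mathcomp Require Import all_boot all_order all_algebra.
From mathcomp Require Import all_classical all_reals all_analysis.
From mathcomp Require Import measurable_realfun ring lra.
Import Order.TTheory GRing.Theory Num.Theory.
Import numFieldNormedType.Exports.
Local Open Scope classical_set_scope.
Local Open Scope ring_scope.

(** Each of the three norms is the [p]-th root of a [partition_sup F] with
    [F >= 0], and such suprema are superadditive in the interval
    ([partition_sup_superadditive]). Conversely, [partition_sup F] is the least
    superadditive function above [F] ([partition_sup_le]). To compare two norms
    it is therefore enough to bound a single term of the first one, on every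
    subinterval [[u, v]], by a constant times the [p]-th power of the second
    norm on [[u, v]] ([partition_sup_poweR_le]).

    V against Vtilde: [d(f u, f v)] is the contribution of the one-interval
    partition to the variation norm on [[u, v]].

    Nhat against V ([N_norm_poweR_le]): cut the domain of the integral of
    [d(f x, f (x + h))^p] into cells of length [h] and translate them all to
    the first one. The integrand becomes a sum over the disjoint intervals
    [[x + j h, x + (j + 1) h]], which is at most [h^(delta p - 1)] times the
    V-supremum; integrating over a cell gives [h^(delta p)] times it, and this
    is the scaling in the definition of [N_norm].

    Vtilde against Nhat ([Vtilde_term_le_Nhat]): the analytic input is the
    embedding [d(f a, f b) <= C (b - a)^(delta - 1/p) N] with [N] the [N_norm]
    on [[a, b]] ([mdist_le_N_norm]). Composing [f] with the distance to [f a]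
    reduces it to a real function [phi]. The average of [phi] over an interval
    and that over one of its halves differ by half the average of
    [phi(x + h) - phi(x)], which [N] controls; halving repeatedly towards an
    endpoint gives a geometric series, convergent because [delta > 1/p], and
    the averages tend to the value of [phi] there by continuity. With
    [M(a, b)] the Nhat-supremum and [th = 1/(p delta)], the embedding says that
    [d(f a, f b)^(1/delta)] is at most a constant times
    [(b - a)^(1 - th) M(a, b)^th]. By Hoelder's inequality this weighted
    geometric mean of two superadditive functions is superadditive, so it also
    bounds the [1/delta]-variation. Raised to the power [delta p] it is
    [(b - a)^(delta p - 1) M(a, b)] up to a constant, and the first factor is
    the weight that a Vtilde-term divides by. *)

(** * Suprema over partitions *)

(** A superadditive function above [F] absorbs the terms of a partition one
    after the other, from the left. *)
Lemma partition_sup_le (R : realType) (F w : R -> R -> \bar R) (s t : R) :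
  (forall a, s <= a <= t -> (0 <= w a a)%E) ->
  (forall a b, s <= a -> a < b -> b <= t -> (F a b <= w a b)%E) ->
  (forall a b c, s <= a -> a <= b -> b <= c -> c <= t ->
    (w a b + w b c <= w a c)%E) ->
  (partition_sup F s t <= w s t)%E.
Proof.
move=> w0 Fw wD; apply: ge_ereal_sup => _ [P sP <-].
elim: P s sP w0 Fw wD => [|x P ih] s sP w0 Fw wD.
  rewrite (itv_partition_nil sP) in w0 *; rewrite big_nil.
  by apply: w0; rewrite lexx.
have sx : s < x by case: sP => /= /andP[].
have xP := itv_partition_cons sP.
have xt := itv_partition_le xP.
rewrite /= big_cons/=; apply: le_trans (wD s x t _ _ _ _) => //; last exact: ltW.
apply: leeD; first exact: Fw.
apply: ih => //.
- by move=> a /andP[xa at_]; rewrite w0// at_ andbT (le_trans (ltW sx)).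
- by move=> a b xa; apply: Fw; rewrite (le_trans (ltW sx)).
- by move=> a b c xa; apply: wD; rewrite (le_trans (ltW sx)).
Qed.

Section partition_sup.
Context {R : realType} (F : R -> R -> \bar R).

Lemma partition_sup_ge1 (a b : R) : a < b -> (F a b <= partition_sup F a b)%E.
Proof.
move=> ab; apply: ereal_sup_ubound; exists [:: b]; first exact: itv_partition1.
by rewrite /= big_seq1.
Qed.

Hypothesis F0 : forall x y, (0 <= F x y)%E.

Lemma partition_sup_ge0 (a b : R) : a <= b -> (0 <= partition_sup F a b)%E.
Proof.
rewrite le_eqVlt => /predU1P[<-|ab].
  by apply: ereal_sup_ubound; exists [::]; [split => /=|rewrite big_nil].
exact: le_trans (F0 _ _) (partition_sup_ge1 _ _ ab).
Qed.

(** Concatenating a partition of [[a, b]] and one of [[b, c]] gives a partition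
    of [[a, c]]. When [b < a] or [c < b], one of the suprema on the left is over
    the empty set, hence [-oo], which absorbs [+oo]. *)
Lemma partition_sup_superadditive (a b c : R) :
  (partition_sup F a b + partition_sup F b c <= partition_sup F a c)%E.
Proof.
have sumD P Q : itv_partition a b P -> itv_partition b c Q ->
    (\sum_(uv <- zip (a :: P) P) F uv.1 uv.2 +
     \sum_(uv <- zip (b :: Q) Q) F uv.1 uv.2 <= partition_sup F a c)%E.
  move=> aP bQ; apply: ereal_sup_ubound; exists (P ++ Q).
    exact: itv_partition_cat aP bQ.
  rewrite -big_cat/=; congr (\big[_/_]_(_ <- _) _).
  case: aP => _ /eqP <-; elim: (P) (a) => //= x P' ih a'.
  by rewrite ih.
have sum0 d P : (0 <= \sum_(uv <- zip (d :: P) P) F uv.1 uv.2)%E.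
  by apply: sume_ge0.
have [->|] := eqVneq (partition_sup F a c) +oo%E; first by rewrite leey.
rewrite -ltey => acy.
have fin P Q : itv_partition a b P -> itv_partition b c Q ->
    (\sum_(uv <- zip (b :: Q) Q) F uv.1 uv.2)%E \is a fin_num.
  move=> aP bQ; rewrite ge0_fin_numE//.
  apply: le_lt_trans acy; apply: le_trans (sumD _ _ aP bQ).
  by rewrite leeDr.
have [[P0 aP0]|nP] := pselect (exists P, itv_partition a b P); last first.
  have -> : partition_sup F a b = -oo%E by
    apply/ereal_sup_ninfty => ? [P aP _]; case: nP; exists P.
  by rewrite addNye leNye.
have [[Q0 bQ0]|nQ] := pselect (exists Q, itv_partition b c Q); last first.
  have -> : partition_sup F b c = -oo%E by
    apply/ereal_sup_ninfty => ? [Q bQ _]; case: nQ; exists Q.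
  by rewrite addeNy leNye.
have abfin : partition_sup F a b \is a fin_num.
  rewrite ge0_fin_numE; last exact: partition_sup_ge0 (itv_partition_le aP0).
  apply: le_lt_trans acy; apply: ge_ereal_sup => _ [P aP <-].
  by apply: le_trans (sumD _ _ aP bQ0); rewrite leeDl.
rewrite addeC -leeBrDr//; apply: ge_ereal_sup => _ [Q bQ <-].
rewrite leeBrDr// addeC -leeBrDr ?(fin _ _ aP0 bQ)//.
apply: ge_ereal_sup => _ [P aP <-].
by rewrite leeBrDr ?(fin _ _ aP bQ)// sumD.
Qed.

Lemma le_partition_sup (s a b t : R) : s <= a -> a <= b -> b <= t ->
  (partition_sup F a b <= partition_sup F s t)%E.
Proof.
move=> sa ab bt; apply: le_trans (partition_sup_superadditive s b t).
apply: le_trans (leeDl _ (partition_sup_ge0 _ _ bt)).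
apply: le_trans (partition_sup_superadditive s a b).
exact: leeDr (partition_sup_ge0 _ _ sa).
Qed.

End partition_sup.

(** * Powers *)

Lemma lee_poweR (R : realType) (x y : \bar R) (r : R) :
  0 <= r -> (0 <= x)%E -> (x <= y)%E -> (x `^ r <= y `^ r)%E.
Proof.
by move=> r0 x0 xy; apply: gt0_ler_poweR => //;
  rewrite in_itv/= leey andbT// (le_trans x0).
Qed.

Lemma poweRK (R : realType) (x : \bar R) (r : R) :
  r != 0 -> (0 <= x)%E -> ((x `^ r) `^ r^-1)%E = x.
Proof. by move=> r0 x0; rewrite -poweRrM divff// poweRe1. Qed.

Lemma poweRVK (R : realType) (x : \bar R) (r : R) :
  r != 0 -> (0 <= x)%E -> ((x `^ r^-1) `^ r)%E = x.
Proof. by move=> r0 x0; rewrite -poweRrM mulVf// poweRe1. Qed.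

Lemma half_powR_lt1 (R : realType) (g : R) : 0 < g -> 2^-1 `^ g < 1 :> R.
Proof.
move=> g0; have := @powR1 R; move=> /(congr1 (@^~ g)) pow1.
by rewrite -[ltRHS]pow1; apply: gt0_ltr_powR => //; rewrite ?nnegrE; lra.
Qed.

(** Hoelder's inequality for two terms, with exponents [1/(1 - th)] and
    [1/th]. *)
Lemma powR_geometric_superadditive (R : realType) (x y z w th : R) :
  0 < th < 1 -> 0 <= x -> 0 <= y -> 0 <= z -> 0 <= w ->
  x `^ (1 - th) * z `^ th + y `^ (1 - th) * w `^ th <=
  (x + y) `^ (1 - th) * (z + w) `^ th.
Proof.
move=> /andP[th0 th1] x0 y0 z0 w0.
have th1' : 0 < 1 - th by rewrite subr_gt0.
have := @hoelder2 R (x `^ (1 - th)) (y `^ (1 - th)) (z `^ th) (w `^ th)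
  (1 - th)^-1 th^-1.
rewrite !powR_ge0 !invr_gt0 !invrK subrK -!powRrM.
by rewrite !divff ?gt_eqF// !powRr1//; apply.
Qed.

(** [C ^ p] times the supremum of [G] is superadditive, so it dominates the
    supremum of [F] as soon as it dominates the single terms [F u v]. *)
Lemma partition_sup_poweR_le (R : realType) (F G : R -> R -> \bar R) (s t C p : R) :
  0 < p -> 0 < C -> s <= t ->
  (forall u v, (0 <= F u v)%E) -> (forall u v, (0 <= G u v)%E) ->
  (forall u v, s <= u -> u < v -> v <= t ->
    (F u v <= (C `^ p)%:E * partition_sup G u v)%E) ->
  (partition_sup F s t `^ p^-1 <= C%:E * partition_sup G s t `^ p^-1)%E.
Proof.
move=> p0 C0 st F0 G0 FG.
have GW0 a b : a <= b -> (0 <= partition_sup G a b)%E by exact: partition_sup_ge0.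
have CpE : C%:E = ((C `^ p)%:E `^ p^-1)%E.
  by rewrite -poweR_EFin poweRK ?gt_eqF// lee_fin ltW.
have Cp0 : (0 <= (C `^ p)%:E)%E by rewrite lee_fin powR_ge0.
rewrite CpE -poweRM ?GW0//; apply: lee_poweR.
- by rewrite invr_ge0 ltW.
- exact: partition_sup_ge0.
apply: (@partition_sup_le _ _ (fun a b => (C `^ p)%:E * partition_sup G a b)%E) => //.
- by move=> a _; rewrite mule_ge0// GW0.
- move=> a b c _ ab bc _; rewrite -ge0_muleDr ?GW0//.
  by apply: lee_wpmul2l => //; exact: partition_sup_superadditive.
Qed.

(** * Continuity, measurability and translation of integrals *)

(** Composing with [clamp a b] extends a function that is continuous within
    [[a, b]] to one that is continuous, hence measurable, on the whole line. *)
Definition clamp {R : realType} (a b x : R) : R := Num.max a (Num.min b x).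

Lemma clamp_id (R : realType) (a b x : R) : a <= x <= b -> clamp a b x = x.
Proof. by move=> /andP[ax xb]; rewrite /clamp min_r// max_r. Qed.

Lemma continuous_clamp (R : realType) (E : topologicalType) (f : R -> E) (a b : R) :
  a <= b -> {within `[a, b], continuous f} ->
  continuous (fun x => f (clamp a b x)).
Proof.
move=> ab /subspace_continuousP fc x.
pose k (x : R) := clamp a b x.
have kab y : `[a, b]%classic (k y).
  by rewrite /= in_itv/= /k /clamp le_max lexx ge_max ab ge_min lexx.
have kc : {for x, continuous k}.
  apply: (@continuous_max R _ (fun=> a)); first exact: cvg_cst.
  by apply: (@continuous_min R _ (fun=> b)); [exact: cvg_cst|exact: cvg_id].
have kw : k @ x --> within `[a, b]%classic (nbhs (k x)).
  move=> A; rewrite /within/= => /kc.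
  apply: (@filterS _ (nbhs x)) => y; apply; exact: kab.
exact: (cvg_comp _ _ kw (fc _ (kab x))).
Qed.

Lemma within_itvS (R : realType) (E : topologicalType) (f : R -> E) (s t a b : R) :
  s <= a -> b <= t -> {within `[s, t], continuous f} -> {within `[a, b], continuous f}.
Proof.
move=> sa bt; apply: continuous_subspaceW => x /=; rewrite !in_itv/=; lra.
Qed.

Lemma continuous_shift (R : realType) (U : topologicalType) (g : R -> U) (h : R) :
  continuous g -> continuous (fun x : R => g (x + h)).
Proof.
move=> gc x; apply: (@continuous_comp _ _ _ (fun x : R => x + h) g); last exact: gc.
by apply: cvgD; [exact: cvg_id|exact: cvg_cst].
Qed.

Lemma continuous_mdist (R : realType) (T : topologicalType) (E : metricType R)
  (f g : T -> E) : continuous f -> continuous g ->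
  continuous (fun x => mdist (f x) (g x) : R^o).
Proof.
move=> fc gc x; apply/cvgrPdist_le => e e0.
have e2 : 0 < e / 2 by rewrite divr_gt0.
near=> y.
have fxy : mdist (f x) (f y) < e / 2.
  by near: y; apply: (metricType_numDomainType.cvgr_dist_lt (fc x)).
have gxy : mdist (g x) (g y) < e / 2.
  by near: y; apply: (metricType_numDomainType.cvgr_dist_lt (gc x)).
have h1 := metric_triangle (f x) (f y) (g x).
have h2 := metric_triangle (f y) (g y) (g x).
have h3 := metric_triangle (f y) (f x) (g y).
have h4 := metric_triangle (f x) (g x) (g y).
rewrite (metric_sym (g y)) in h2; rewrite (metric_sym (f y) (f x)) in h3.
rewrite ler_norml; lra.
Unshelve. all: by end_near. Qed.

Lemma measurable_increment (R : realType) (E : metricType R) (f : R -> E)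
    (h p : R) : continuous f ->
  measurable_fun [set: R] (fun x => (mdist (f x) (f (x + h)) `^ p)%:E).
Proof.
move=> fc; apply/measurable_EFinP; apply: (measurableT_comp (measurable_powR p)).
apply: continuous_measurable_fun; apply: continuous_mdist => //.
exact: continuous_shift.
Qed.

Lemma continuous_integrable_itv (R : realType) (g : R -> R) (a b : R) :
  continuous g -> lebesgue_measure.-integrable `[a, b] (EFin \o g).
Proof.
move=> gc; apply: continuous_compact_integrable; first exact: segment_compact.
exact: continuous_subspaceT.
Qed.

(** The Lebesgue measure is translation invariant: it agrees with its image
    under a translation on half-open intervals, hence on all Borel sets. *)
Lemma ge0_integral_shift (R : realType) (D : set R) (f : R -> \bar R) (h : R) :
  measurable D -> measurable_fun D (f : measurableTypeR R -> \bar R) ->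
  (forall x, D x -> (0 <= f x)%E) ->
  (\int[lebesgue_measure]_(x in D) f x =
   \int[lebesgue_measure]_(x in (fun x : R => (x + h)%R) @^-1` D) f (x + h)%R)%E.
Proof.
move=> mD mf f0.
pose phi : measurableTypeR R -> measurableTypeR R := fun x => x + h.
have mphi : measurable_fun setT phi by apply: measurable_funD.
rewrite -[RHS](@ge0_integral_pushforward _ _ _ _ R phi mphi lebesgue_measure D f)//;
  last by move=> x /[!inE]; exact: f0.
apply: eq_measure_integral => //= A mA AD.
apply: lebesgue_measure_unique => //= _ [[a b]] _ <-.
rewrite /pushforward.
have -> : phi @^-1` `]a, b]%classic = `]a - h, b - h]%classic.
  by apply/seteqP; split => x /=; rewrite !in_itv/= /phi lerBrDr ltrBlDr.
rewrite !lebesgue_measure_itv/= !lte_fin ltrD2r -!EFinB.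
by congr (if _ then _%:E else _); lra.
Qed.

(** * The N-norm is bounded by the V-supremum *)

(** [V_term], [Vtilde_term] and [N_term] are the summands in the definitions of
    [V_norm], [Vtilde_norm] and [Nhat_norm]. *)
Definition V_term {R : realType} {E : metricType R} (delta p : R) (f : R -> E)
    (u v : R) : \bar R :=
  (mdist (f u) (f v) `^ p / `|v - u| `^ (delta * p - 1))%:E.

Lemma V_term_ge0 (R : realType) (E : metricType R) (delta p : R) (f : R -> E)
    (u v : R) : (0 <= V_term delta p f u v)%E.
Proof. by rewrite lee_fin divr_ge0 ?powR_ge0. Qed.

(** Folding the [n] cells of length [h] onto the first one turns a pointwise
    bound on the sums along [x, x + h, x + 2h, ...] into a bound on the
    integral. *)
Lemma ge0_integral_cells_le (R : realType) (G : R -> \bar R) (c h M : R) n :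
  0 < h -> measurable_fun setT G -> (forall x, (0 <= G x)%E) ->
  (forall x, c <= x < c + h -> (\sum_(j < n) G (x + j%:R * h)%R <= M%:E)%E) ->
  (\int[lebesgue_measure]_(x in `[c, (c + n%:R * h)%R[) G x <= (h * M)%:E)%E.
Proof.
move=> h0 mG G0 GM.
have mGs j : measurable_fun setT (fun x : R => G (x + j%:R * h)%R).
  by apply: measurableT_comp => //; exact: measurable_funD.
have cells m : (\int[lebesgue_measure]_(x in `[c, (c + m%:R * h)%R[) G x =
   \int[lebesgue_measure]_(x in `[c, (c + h)%R[)
     \sum_(j < m) G (x + j%:R * h)%R)%E.
  elim: m => [|m ih].
    rewrite mul0r addr0 set_itvco0 integral_set0.
    by rewrite (eq_integral (cst 0%E)) ?integral0// => x _; rewrite big_ord0.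
  have mh0 : 0 <= m%:R * h by rewrite mulr_ge0// ltW.
  have mS : (c + m.+1%:R * h = c + m%:R * h + h)%R by rewrite -natr1; ring.
  have -> : `[c, (c + m.+1%:R * h)%R[%classic =
      `[c, (c + m%:R * h)%R[%classic `|` `[(c + m%:R * h)%R, (c + m.+1%:R * h)%R[%classic.
    by rewrite mS -itv_bndbnd_setU// bnd_simp; lra.
  rewrite ge0_integral_setU//; last 2 first.
  - exact: measurable_funTS.
  - apply/disj_setPS => x [/=]; rewrite !in_itv/= => /andP[_ x1] /andP[x2 _].
    by move: (le_lt_trans x2 x1); rewrite ltxx.
  under [RHS]eq_integral do rewrite big_ord_recr/=.
  rewrite ge0_integralD//; first last.
  - exact: measurable_funTS (mGs m).
  - by apply: measurable_funTS; apply: emeasurable_sum => j; exact: mGs.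
  - by move=> x _; apply: sume_ge0.
  rewrite ih; congr (_ + _)%E.
  rewrite (ge0_integral_shift _ _ _ (m%:R * h))//; last exact: measurable_funTS mG.
  congr (integral _ _ _); apply/seteqP; split => x /=; rewrite !in_itv/= mS; lra.
rewrite cells.
apply: (@le_trans _ _
  (\int[lebesgue_measure]_(x in `[c, (c + h)%R[) cst M%:E x)%E); last first.
  rewrite integral_cst//= lebesgue_measure_itv/= lte_fin ltrDl h0 -EFinD -EFinM.
  by rewrite lee_fin addrAC subrr add0r mulrC.
apply: ge0_le_integral => //.
- by move=> x _; apply: sume_ge0.
- by apply: measurable_funTS; apply: emeasurable_sum => j; exact: mGs.
Qed.

(** The intervals of length [h] that start at [a], stacked as long as they stay
    below [v], are disjoint subintervals of [[a, v]]; each increment is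
    [h ^ (delta p - 1)] times its V-term. *)
Lemma sum_increments_le (R : realType) (E : metricType R) (delta p : R)
    (f : R -> E) (h v a : R) n : 0 < h -> a <= v ->
  (\sum_(j < n) (if (a + j%:R * h + h <= v)%R then
      (mdist (f (a + j%:R * h)%R) (f (a + j%:R * h + h)%R) `^ p)%:E else 0%E) <=
   (h `^ (delta * p - 1))%:E * partition_sup (V_term delta p f) a v)%E.
Proof.
move=> h0; elim: n a => [|n ih] a av.
  rewrite big_ord0; apply: mule_ge0; first by rewrite lee_fin powR_ge0.
  by apply: partition_sup_ge0 => // *; exact: V_term_ge0.
have [ahv|ahv] := leP (a + h) v; last first.
  rewrite big1; last first.
    move=> j _; case: ifPn => //; have : 0 <= j%:R * h by rewrite mulr_ge0// ltW.
    by move=> ? ?; exfalso; lra.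
  apply: mule_ge0; first by rewrite lee_fin powR_ge0.
  by apply: partition_sup_ge0 => // *; exact: V_term_ge0.
rewrite big_ord_recl/= mul0r !addr0 ahv.
apply: le_trans (lee_wpmul2l _ (partition_sup_superadditive _ _ a (a + h) v));
  last 2 first.
  by rewrite lee_fin powR_ge0.
  exact: V_term_ge0.
rewrite ge0_muleDr; last 2 first.
- by apply: partition_sup_ge0 => *; [exact: V_term_ge0|lra].
- by apply: partition_sup_ge0 => *; [exact: V_term_ge0|lra].
apply: leeD; last first.
  apply: le_trans (ih _ ahv); rewrite le_eqVlt; apply/orP; left; apply/eqP.
  apply: eq_bigr => j _.
  have -> : (a + (bump 0 j)%:R * h = a + h + j%:R * h)%R.
    by rewrite /= /bump/= natrD; ring.
  by [].
apply: (@le_trans _ _ ((h `^ (delta * p - 1))%:E * V_term delta p f a (a + h))%E).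
  rewrite -EFinM addrAC subrr add0r gtr0_norm// mulrCA divff ?mulr1//.
  by rewrite gt_eqF// powR_gt0.
apply: lee_wpmul2l; first by rewrite lee_fin powR_ge0.
by apply: partition_sup_ge1; lra.
Qed.

Lemma integral_increments_le (R : realType) (E : metricType R) (delta p : R)
    (f : R -> E) (u v h : R) :
  {within `[u, v], continuous f} -> 0 < h -> h <= v - u ->
  (\int[lebesgue_measure]_(x in `[u, (v - h)%R])
     (mdist (f x) (f (x + h)%R) `^ p)%:E <=
   (h `^ (delta * p))%:E * partition_sup (V_term delta p f) u v)%E.
Proof.
move=> fc h0 huv; have uv : u <= v by lra.
have W0 : (0 <= partition_sup (V_term delta p f) u v)%E.
  by apply: partition_sup_ge0 => // *; exact: V_term_ge0.
have [->|Wy] := eqVneq (partition_sup (V_term delta p f) u v) +oo%E.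
  by rewrite gt0_muley ?leey// lte_fin powR_gt0.
have Wfin : partition_sup (V_term delta p f) u v \is a fin_num.
  by rewrite ge0_fin_numE// ltey.
pose g x := f (clamp u v x).
have gc : continuous g by exact: continuous_clamp.
have gE x : u <= x <= v -> g x = f x by move=> /clamp_id; rewrite /g => ->.
pose k x := (mdist (g x) (g (x + h)) `^ p)%:E.
have mk : measurable_fun [set: R] k by exact: measurable_increment.
(* Vanishing outside the domain lets G be integrated over whole cells. *)
pose G := k \_ `[u, (v - h)%R].
have mG : measurable_fun setT G.
  by apply/(measurable_restrictT _ _).1 => //; exact: measurable_funTS.
have G0 x : (0 <= G x)%E.
  by apply: erestrict_ge0 => y _; rewrite lee_fin powR_ge0.
have vuh0 : 0 <= (v - u) / h by rewrite divr_ge0//; lra.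
set n := Num.bound ((v - u) / h).
have nP : v - u < n%:R * h by rewrite -ltr_pdivrMr// archi_boundP.
apply: (@le_trans _ _
  (\int[lebesgue_measure]_(x in `[u, (u + n%:R * h)%R[) G x)%E).
  rewrite [leLHS](_ : _ =
    \int[lebesgue_measure]_(x in `[u, (v - h)%R]) G x)%E; last first.
    apply: eq_integral => x; rewrite inE/= => xuv; rewrite /G patchE mem_set// /k.
    by move: xuv; rewrite in_itv/= => xuv; rewrite !gE//; lra.
  apply: ge0_subset_integral => //; first exact: measurable_funTS.
  by move=> x /=; rewrite !in_itv/=; lra.
have -> : (h `^ (delta * p))%:E = (h * h `^ (delta * p - 1))%:E.
  by congr _%:E; rewrite -{2}(powRr1 (ltW h0)) -powRD ?subrKC// (gt_eqF h0) implybT.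
rewrite EFinM -muleA -[X in (_ <= _ * X)%E]fineK ?fin_numM// -EFinM.
apply: ge0_integral_cells_le => // x /andP[ux xuh].
rewrite fineK ?fin_numM//.
apply: (@le_trans _ _
  ((h `^ (delta * p - 1))%:E * partition_sup (V_term delta p f) x v)%E);
  last first.
  apply: lee_wpmul2l; first by rewrite lee_fin powR_ge0.
  apply: le_partition_sup => //; [exact: V_term_ge0|lra].
have xv : x <= v by lra.
apply: le_trans (sum_increments_le _ _ delta p f h v x n h0 xv).
apply: lee_sum => j _; have jh0 : 0 <= j%:R * h by rewrite mulr_ge0// ltW.
rewrite /G patchE; case: ifPn => [|_]; last by case: ifPn => //; rewrite lee_fin powR_ge0.
rewrite inE/= in_itv/= => xuv; have -> : x + j%:R * h + h <= v by lra.
by rewrite /k !gE//; lra.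
Qed.

Lemma N_norm_ge0 (R : realType) (E : metricType R) (delta p : R) (f : R -> E)
    (u v : R) : u < v -> (0 <= N_norm delta p f u v)%E.
Proof.
move=> uv; apply: le_ereal_sup_tmp; eexists.
  by exists (v - u) => //=; rewrite in_itv/= subr_gt0 uv lexx.
by rewrite mule_ge0 ?poweR_ge0// lee_fin powR_ge0.
Qed.

Lemma N_norm_poweR_le (R : realType) (E : metricType R) (delta p : R)
    (f : R -> E) (u v : R) :
  {within `[u, v], continuous f} -> 0 < p -> u < v ->
  (N_norm delta p f u v `^ p <= partition_sup (V_term delta p f) u v)%E.
Proof.
move=> fc p0 uv; set W := partition_sup _ _ _.
have pN0 : p != 0 by rewrite gt_eqF.
have W0 : (0 <= W)%E.
  by apply: partition_sup_ge0 => // *; [exact: V_term_ge0|exact: ltW].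
have N0 := N_norm_ge0 _ _ delta p f u v uv.
rewrite -[leRHS](poweRVK _ _ _ pN0 W0); apply: lee_poweR => //; first exact: ltW.
apply: ge_ereal_sup => _ [h + <-]; rewrite /= in_itv/= => /andP[h0 huv].
have hd0 : 0 < h `^ delta by exact: powR_gt0.
rewrite powRN -[leRHS]mul1e -(mulVf (lt0r_neq0 hd0)) EFinM -muleA.
apply: lee_wpmul2l; first by rewrite lee_fin invr_ge0 ltW.
have -> : (h `^ delta)%:E = ((h `^ (delta * p))%:E `^ p^-1)%E.
  by rewrite poweR_EFin -powRrM mulfK.
rewrite -poweRM ?lee_fin ?powR_ge0//; apply: lee_poweR.
- by rewrite invr_ge0 ltW.
- by apply: integral_ge0 => x _; rewrite lee_fin powR_ge0.
- exact: integral_increments_le.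
Qed.

(** * The Hoelder embedding *)

Lemma integral_le_N_norm (R : realType) (E : metricType R) (delta p N : R)
    (f : R -> E) (u v h : R) :
  0 < p -> 0 <= N -> 0 < h -> h <= v - u -> (N_norm delta p f u v <= N%:E)%E ->
  (\int[lebesgue_measure]_(x in `[u, (v - h)%R])
     (mdist (f x) (f (x + h)%R) `^ p)%:E <= ((N * h `^ delta) `^ p)%:E)%E.
Proof.
move=> p0 N0 h0 huv NN; set I := (X in (X <= _)%E).
have I0 : (0 <= I)%E by apply: integral_ge0 => x _; rewrite lee_fin powR_ge0.
have pN0 : p != 0 by rewrite gt_eqF.
have hd0 : 0 < h `^ delta by exact: powR_gt0.
rewrite -(poweRVK _ _ _ pN0 I0) -poweR_EFin.
apply: lee_poweR; [exact: ltW|exact: poweR_ge0|].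
rewrite EFinM muleC -lee_pdivrMl// -powRN.
apply: le_trans NN; apply: ereal_sup_ubound; exists h => //.
by rewrite /= in_itv/= h0.
Qed.

(** Jensen's inequality up to the factor [2], obtained by integrating the
    pointwise bound [|g| <= K + K^(1 - p) |g|^p]. *)
Lemma normr_Rintegral_le_powR (R : realType) (g : R -> R) (c h p K : R) :
  continuous g -> 0 < h -> 1 <= p -> 0 < K ->
  (\int[lebesgue_measure]_(x in `[c, (c + h)%R]) (`|g x| `^ p)%:E <= (K `^ p * h)%:E)%E ->
  `|\int[lebesgue_measure]_(x in `[c, c + h]) g x| <= 2 * K * h.
Proof.
move=> gc h0 p1 K0 gp.
have mgp : measurable_fun [set: R] (fun x => (`|g x| `^ p)%:E).
  apply/measurable_EFinP; apply: (measurableT_comp (measurable_powR p)).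
  by apply: measurableT_comp => //; exact: continuous_measurable_fun.
have gig := continuous_integrable_itv R g c (c + h) gc.
rewrite -lee_fin EFin_normr_Rintegral//.
apply: (le_trans (le_abse_integral _ _ _)) => //;
  first exact: (measurable_int lebesgue_measure).
(* Where |g| exceeds K, the factor (|g| / K) ^ (p - 1) is at least 1. *)
have gK x : (`|(g x)%:E| <= K%:E + (K `^ (1 - p))%:E * (`|g x| `^ p)%:E)%E.
  rewrite -EFinM -EFinD abse_EFin lee_fin.
  have [gK|Kg] := leP `|g x| K.
    by rewrite (le_trans gK)// lerDl mulr_ge0 ?powR_ge0.
  have g0 : 0 < `|g x| by apply: lt_trans Kg.
  apply: ler_wpDl; first exact: ltW.
  rewrite -[leLHS](powRr1 (ltW g0)) -[X in _ `^ X](subrK p 1) powRD;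
    last by rewrite (gt_eqF g0) implybT.
  apply: ler_wpM2r; first exact: powR_ge0.
  rewrite -(opprB p 1) !powRN lef_pV2 ?posrE ?powR_gt0//.
  by apply: ge0_ler_powR; rewrite ?nnegrE ?subr_ge0//; exact: ltW.
apply: (@le_trans _ _
  (\int[lebesgue_measure]_(x in `[c, (c + h)%R])
   (cst K%:E x + (K `^ (1 - p))%:E * (`|g x| `^ p)%:E))%E).
  apply: ge0_le_integral => //.
  - by move: gig => /integrableP[mg _]; apply: measurableT_comp.
  - apply: emeasurable_funD => //; apply: measurable_funeM; exact: measurable_funTS.
rewrite ge0_integralD//; last 3 first.
- by move=> x _; rewrite lee_fin ltW.
- by move=> x _; rewrite mule_ge0 ?lee_fin ?powR_ge0.
- by apply: measurable_funeM; exact: measurable_funTS.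
rewrite integral_cst//= lebesgue_measure_itv/= lte_fin ltrDl h0 -EFinD.
rewrite addrAC subrr add0r ge0_integralZl_EFin ?powR_ge0//; last exact: measurable_funTS.
apply: (@le_trans _ _ (K%:E * h%:E + (K `^ (1 - p))%:E * (K `^ p * h)%:E)%E).
  by apply: leeD => //; apply: lee_wpmul2l; rewrite ?lee_fin ?powR_ge0.
rewrite -!EFinM -EFinD lee_fin mulrA -powRD ?subrK ?(gt_eqF K0) ?implybT//.
by rewrite (powRr1 (ltW K0)); lra.
Qed.

Lemma Rintegral_double (R : realType) (phi : R -> R) (c h : R) :
  continuous phi -> 0 < h ->
  \int[lebesgue_measure]_(x in `[c, c + (h + h)]) phi x =
  \int[lebesgue_measure]_(x in `[c, c + h]) phi x +
  \int[lebesgue_measure]_(x in `[c + h, c + h + h]) phi x.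
Proof.
move=> phic h0.
have I a b := continuous_integrable_itv R phi a b phic.
have := @Rintegral_itvB R phi (BLeft c) (BRight (c + (h + h))) (c + h) (I _ _).
rewrite !bnd_simp => /(_ ltac:(lra) ltac:(lra)).
rewrite Rintegral_itv_obnd_cbnd; last first.
  apply: integrableS (I (c + h) (c + (h + h))) => //.
  by move=> x /=; rewrite !in_itv/= => /andP[/ltW -> ->].
by rewrite addrA => <-; rewrite [RHS]addrC subrK.
Qed.

Lemma Rintegral_shift (R : realType) (phi : R -> R) (c h : R) :
  continuous phi -> (forall x, 0 <= phi x) ->
  \int[lebesgue_measure]_(x in `[c + h, c + h + h]) phi x =
  \int[lebesgue_measure]_(x in `[c, c + h]) phi (x + h).
Proof.
move=> phic phi0; rewrite /Rintegral; congr fine.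
rewrite (ge0_integral_shift _ _ _ h)//=; last 2 first.
- apply/measurable_EFinP; apply: measurable_funTS; exact: continuous_measurable_fun.
- by move=> x _; rewrite lee_fin.
by congr (integral _ _ _); apply/seteqP; split => x /=; rewrite !in_itv/=; lra.
Qed.

Definition average {R : realType} (phi : R -> R) (c h : R) : R :=
  h^-1 * \int[lebesgue_measure]_(x in `[c, c + h]) phi x.

(** The average over an interval is the mean of those over its halves, so it
    differs from either by half the average of the increments
    [phi (x + h) - phi x]. The boolean [sg] selects the left or the right
    half. *)
Lemma average_half (R : realType) (phi : R -> R) (c h p K : R) (sg : bool) :
  continuous phi -> (forall x, 0 <= phi x) -> 0 < h -> 1 <= p -> 0 < K ->
  (\int[lebesgue_measure]_(x in `[c, (c + h)%R]) (`|phi (x + h)%R - phi x| `^ p)%:E <=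
    (K `^ p * h)%:E)%E ->
  `|average phi c (h + h) - average phi (c + sg%:R * h) h| <= K.
Proof.
move=> phic phi0 h0 p1 K0 incr.
have phihc : continuous (fun x : R => phi (x + h)) by exact: continuous_shift.
have gc : continuous (fun x : R => phi (x + h) - phi x).
  by move=> x; apply: cvgB; [exact: phihc|exact: phic].
have := normr_Rintegral_le_powR _ _ _ _ _ _ gc h0 p1 K0 incr.
rewrite RintegralB//; [|exact: continuous_integrable_itv..].
rewrite /average Rintegral_double// Rintegral_shift//.
set A := \int[lebesgue_measure]_(x in `[c, c + h]) phi (x + h).
set B := \int[lebesgue_measure]_(x in `[c, c + h]) phi x.

have -> : \int[lebesgue_measure]_(x in `[c + sg%:R * h, c + sg%:R * h + h]) phi x =
    if sg then A else B.
  by case: sg; rewrite ?mul1r ?mul0r ?addr0// Rintegral_shift.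
move=> AB.
have -> : (h + h)^-1 * (B + A) - h^-1 * (if sg then A else B) =
    (if sg then -1 else 1) * ((A - B) / (2 * h)).
  by case: sg; field; rewrite gt_eqF//; lra.
rewrite normrM (_ : `|if sg then -1 else 1| = 1) ?mul1r; last first.
  by case: sg; rewrite ?normrN normr1.
rewrite normrM normfV (gtr0_norm (_ : 0 < 2 * h)) ?mulr_gt0//.
by rewrite ler_pdivrMr ?mulr_gt0// mulrCA mulrA.
Qed.

Lemma average_near (R : realType) (phi : R -> R) (x e : R) :
  continuous phi -> 0 < e ->
  exists2 r : R, 0 < r & forall c h, 0 < h -> h < r -> c <= x <= c + h ->
    `|average phi c h - phi x| <= e.
Proof.
move=> phic e0.
have /cvgrPdist_le /(_ _ e0) := phic x.
move=> /nbhs_ballP[r /= r0 rP]; exists r => // c h h0 hr xch.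
have I (g : R -> R) : continuous g ->
    lebesgue_measure.-integrable `[c, c + h] (EFin \o g).
  exact: continuous_integrable_itv.
have Ic : lebesgue_measure.-integrable `[c, c + h] (EFin \o cst (phi x)).
  by apply: I => y; exact: cvg_cst.
have icst y : \int[lebesgue_measure]_(x in `[c, c + h]) y = y * h.
  rewrite Rintegral_cst//= lebesgue_measure_itv/= lte_fin ltrDl h0 -EFinD/=.
  by congr (_ * _); ring.
have -> : average phi c h - phi x =
    h^-1 * \int[lebesgue_measure]_(y in `[c, c + h]) (phi y - phi x).
  rewrite RintegralB//; last exact: I.
  by rewrite icst /average mulrBr [h^-1 * (_ * h)]mulrCA mulVf ?mulr1// gt_eqF.
rewrite normrM normfV (gtr0_norm h0) mulrC ler_pdivrMr//.
have dc : continuous (fun y => phi y - phi x).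
  by move=> y; apply: cvgB; [exact: phic|exact: cvg_cst].
rewrite (le_trans (le_normr_Rintegral _ _))//; first exact: I.
rewrite -icst; apply: le_Rintegral => //.
- by apply: (I (fun y => `|phi y - phi x|)) => y; apply: cvg_norm; exact: dc.
- by apply: I => y; exact: cvg_cst.
move=> y /=; rewrite in_itv/= distrC => ych; apply: rP.
by rewrite /ball/= ltr_norml; lra.
Qed.

(** Halving [[a, b]] repeatedly towards an endpoint ([b] if [sg], [a]
    otherwise), the successive averages differ by at most
    [K (b - a)^g 2^(- g k)] and tend to the value of [phi] at this endpoint;
    [1 - 2^(- g)] comes from summing the geometric series. *)
Lemma average_chain (R : realType) (phi : R -> R) (a b p g K : R) (sg : bool) :
  continuous phi -> (forall x, 0 <= phi x) -> a < b -> 1 <= p -> 0 < g -> 0 < K ->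
  (forall c h, 0 < h -> a <= c -> c + (h + h) <= b ->
    (\int[lebesgue_measure]_(x in `[c, (c + h)%R]) (`|phi (x + h)%R - phi x| `^ p)%:E <=
      ((K * h `^ g) `^ p * h)%:E)%E) ->
  `|average phi a (b - a) - phi (if sg then b else a)| <=
    K * (b - a) `^ g / (1 - 2^-1 `^ g).
Proof.
move=> phic phi0 ab p1 g0 K0 incr.
have L0 : 0 < b - a by rewrite subr_gt0.
set q := 2^-1 `^ g.
have q0 : 0 < q by apply: powR_gt0; lra.
have q1 : q < 1 by exact: half_powR_lt1.
set B := _ / _.
(* The nested intervals [c k, c k + h k] are obtained by keeping, each time,
   the half that contains the chosen endpoint. *)
pose h k : R := (b - a) * 2^-1 ^+ k.
pose c k : R := if sg then b - h k else a.
have h_gt0 k : 0 < h k by rewrite mulr_gt0// exprn_gt0//; lra.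
have hS k : h k = h k.+1 + h k.+1 by rewrite /h exprS; lra.
have hle k : h k <= b - a.
  rewrite /h -[leRHS]mulr1 ler_pM2l//; apply: exprn_ile1; lra.
have cS k : c k.+1 = c k + sg%:R * h k.+1.
  by rewrite /c; case: (sg); rewrite ?mul1r ?mul0r ?addr0// (hS k); ring.
have chain k : `|average phi a (b - a) - average phi (c k) (h k)| <= B * (1 - q ^+ k).
  elim: k => [|k ih].
    have -> : h 0 = b - a by rewrite /h expr0 mulr1.
    have -> : c 0 = a by rewrite /c /h expr0 mulr1; case: (sg) => //; ring.
    by rewrite subrr normr0 expr0 subrr mulr0.
  have step : `|average phi (c k) (h k) - average phi (c k.+1) (h k.+1)| <=
      K * h k.+1 `^ g.
    rewrite cS hS; apply: (average_half _ _ _ _ p) => //.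
      by rewrite mulr_gt0 ?powR_gt0.
    move: (hS k) (h_gt0 k.+1) (hle k); rewrite /c.
    by move: (h k) (h k.+1) => x y *; apply: incr => //; case: (sg) => /=; lra.
  have hg : K * h k.+1 `^ g = B * (1 - q) * q ^+ k.+1.
    rewrite /B divfK ?subr_eq0 ?gt_eqF//.
    have i0 : 0 <= 2^-1 ^+ k.+1 :> R by apply: exprn_ge0; lra.
    rewrite /h (powRM _ (ltW L0) i0).
    rewrite mulrA; congr (_ * _).
    by rewrite -!powR_mulrn ?powR_ge0// powRAC.
  have B0 : 0 <= B.
    by rewrite /B !mulr_ge0 ?powR_ge0 ?(ltW K0)// invr_ge0; lra.
  rewrite (le_trans (ler_distD (average phi (c k) (h k)) _ _))//.
  rewrite (le_trans (lerD ih step))// hg -[_ * _ * q ^+ _]mulrA -mulrDr ler_wpM2l//.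
  rewrite exprS; have qk : 0 <= q ^+ k by rewrite exprn_ge0 ?ltW.
  have := mulr_ge0 qk (sqr_ge0 (1 - q)).
  by move: (q ^+ k) => t; clearbody q; rewrite expr2; lra.
apply/ler_addgt0Pr => e e0.
have [r r0 rP] := average_near _ phi (if sg then b else a) e phic e0.
have [k hkr] : exists k, h k < r.
  have rL : 0 <= (b - a) / r by rewrite divr_ge0// ltW.
  exists (Num.bound ((b - a) / r)); have := archi_boundP rL; set m := Num.bound _.
  rewrite ltr_pdivrMr// => Lm; rewrite /h exprVn ltr_pdivrMr ?exprn_gt0//.
  apply: (lt_le_trans Lm); rewrite mulrC ler_pM2l// -natrX ler_nat.
  exact: ltnW (ltn_expl _ _).
have ek : c k <= (if sg then b else a) <= c k + h k.
  by move: (h_gt0 k); rewrite /c; move: (h k) => y y0; case: (sg) => /=; lra.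
rewrite (le_trans (ler_distD (average phi (c k) (h k)) _ _))//.
apply: lerD; last exact: rP.
rewrite (le_trans (chain k))// ler_piMr//.
  by rewrite /B !mulr_ge0 ?powR_ge0 ?(ltW K0)// invr_ge0; lra.
by rewrite lerBlDr lerDl exprn_ge0// ltW.
Qed.

Definition embedding_const {R : realType} (delta p : R) : R :=
  2 / (1 - 2^-1 `^ (delta - p^-1)).

Lemma embedding_const_gt0 (R : realType) (delta p : R) :
  p^-1 < delta -> 0 < embedding_const delta p.
Proof. by move=> dp; rewrite divr_gt0// subr_gt0 half_powR_lt1// subr_gt0. Qed.

(** The function [phi x = d(f x, f a)] has increments bounded by those of [f]
    and satisfies [phi a = 0], [phi b = d(f a, f b)]; both values are close to
    the average of [phi] over [[a, b]]. *)
Lemma mdist_le_N_norm (R : realType) (E : metricType R) (delta p N : R)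
    (f : R -> E) (a b : R) :
  1 <= p -> p^-1 < delta -> 0 <= N -> a < b -> {within `[a, b], continuous f} ->
  (N_norm delta p f a b <= N%:E)%E ->
  mdist (f a) (f b) <=
    embedding_const delta p * (N * (b - a) `^ (delta - p^-1)).
Proof.
move=> p1 dp N0 ab fc NN; rewrite /embedding_const.
set g := delta - p^-1; set D := 1 - _.
have p0 : 0 < p by lra.
have g0 : 0 < g by rewrite subr_gt0.
have D0 : 0 < D by rewrite subr_gt0 half_powR_lt1.
have Lg : 0 < (b - a) `^ g by rewrite powR_gt0 ?subr_gt0.
pose f' x := f (clamp a b x).
have fc' : continuous f' by exact: continuous_clamp (ltW ab) fc.
have f'E x : a <= x <= b -> f' x = f x by move=> /clamp_id; rewrite /f' => ->.
pose phi x : R := mdist (f' x) (f a).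
have phic : continuous phi.
  by apply: (continuous_mdist _ _ _ f' (fun=> f a)) => // x; exact: cvg_cst.
have phi0 x : 0 <= phi x by exact: mdist_ge0.
(* Strict inequality makes K positive, as the chain of averages requires; K is
   let tend to N at the end. *)
have incr K : N < K -> forall c h, 0 < h -> a <= c -> c + (h + h) <= b ->
    (\int[lebesgue_measure]_(x in `[c, (c + h)%R]) (`|phi (x + h)%R - phi x| `^ p)%:E <=
      ((K * h `^ g) `^ p * h)%:E)%E.
  move=> NK c h h0 ac chb.
  have K0 : 0 <= K by lra.
  have mk := measurable_increment _ _ f' h p fc'.
  apply: (@le_trans _ _
  (\int[lebesgue_measure]_(x in `[c, (c + h)%R])
      (mdist (f' x) (f' (x + h)%R) `^ p)%:E)%E).
    apply: ge0_le_integral => //.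
    - apply/measurable_EFinP; apply: (measurableT_comp (measurable_powR p)).
      apply: measurableT_comp => //; apply: measurable_funTS.
      apply: continuous_measurable_fun => x; apply: cvgB; last exact: phic.
      exact: continuous_shift phic _.
    - exact: measurable_funTS.
    - move=> x _; rewrite lee_fin; apply: ge0_ler_powR; rewrite ?nnegrE ?mdist_ge0//.
        exact: ltW.
      have h1 := metric_triangle (f' (x + h)) (f' x) (f a).
      have h2 := metric_triangle (f' x) (f' (x + h)) (f a).
      rewrite (metric_sym (f' (x + h)) (f' x)) in h1.
      by rewrite /phi ler_norml; lra.
  apply: (@le_trans _ _
  (\int[lebesgue_measure]_(x in `[a, (b - h)%R])
      (mdist (f' x) (f' (x + h)%R) `^ p)%:E)%E).
    apply: ge0_subset_integral => //; first exact: measurable_funTS.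
    - by move=> x _; rewrite lee_fin powR_ge0.
    - by move=> x /=; rewrite !in_itv/=; lra.
  rewrite [leLHS](_ : _ = \int[lebesgue_measure]_(x in `[a, (b - h)%R])
      (mdist (f x) (f (x + h)%R) `^ p)%:E)%E; last first.
    apply: eq_integral => x; rewrite inE/= in_itv/= => xab.
    by rewrite !f'E//; lra.
  have hba : h <= b - a by lra.
  apply: (le_trans (integral_le_N_norm _ _ delta p N f a b h p0 N0 h0 hba NN)).
  rewrite lee_fin; apply: (@le_trans _ _ ((K * h `^ delta) `^ p)).
    apply: ge0_ler_powR; rewrite ?nnegrE ?mulr_ge0 ?powR_ge0//; first exact: ltW.
    by rewrite ler_wpM2r ?powR_ge0// ltW.
  rewrite !powRM ?powR_ge0// -mulrA ler_wpM2l ?powR_ge0//.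
  rewrite -!powRrM -[X in _ <= _ * X](powRr1 (ltW h0)) -powRD ?(gt_eqF h0) ?implybT//.
  by rewrite /g mulrBl mulVf ?gt_eqF// subrK.
have bound K : N < K -> mdist (f a) (f b) <= 2 / D * (K * (b - a) `^ g).
  move=> NK; have K0 : 0 < K by lra.
  have cb := average_chain _ phi a b p g K true phic phi0 ab p1 g0 K0 (incr _ NK).
  have ca := average_chain _ phi a b p g K false phic phi0 ab p1 g0 K0 (incr _ NK).
  have phia : phi a = 0 by rewrite /phi f'E ?mdistxx// lexx ltW.
  have phib : phi b = mdist (f a) (f b).
    by rewrite /phi f'E ?lexx ?ltW// metric_sym.
  rewrite -phib -[leLHS]subr0 -phia.
  have -> : 2 / D * (K * (b - a) `^ g) = K * (b - a) `^ g / D + K * (b - a) `^ g / D.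
    by field; rewrite gt_eqF.
  apply: le_trans (lerD cb ca); rewrite distrC.
  apply: le_trans (ler_norm _) _; exact: le_trans (ler_distD _ _ _) _.
apply/ler_addgt0Pr => e e0.
pose c := 2 / D * (b - a) `^ g.
have c0 : 0 < c by rewrite !mulr_gt0// invr_gt0.
apply: (le_trans (bound (N + e / c) _)); first by rewrite ltrDl divr_gt0.
rewrite le_eqVlt; apply/orP; left; apply/eqP; rewrite /c; field.
by rewrite !gt_eqF.
Qed.

(** * The variation norm is bounded by the Nhat-supremum *)

Definition N_term {R : realType} {E : metricType R} (delta p : R) (f : R -> E)
    (u v : R) : \bar R := (N_norm delta p f u v `^ p)%E.

Definition Vtilde_term {R : realType} {E : metricType R} (delta p : R)
    (f : R -> E) (u v : R) : \bar R :=
  (var_norm delta^-1 f u v `^ p * ((`|v - u| `^ (delta * p - 1))^-1)%:E)%E.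

Lemma N_term_ge0 (R : realType) (E : metricType R) (delta p : R) (f : R -> E)
    (u v : R) : (0 <= N_term delta p f u v)%E.
Proof. exact: poweR_ge0. Qed.

Lemma Vtilde_term_ge0 (R : realType) (E : metricType R) (delta p : R) (f : R -> E)
    (u v : R) : (0 <= Vtilde_term delta p f u v)%E.
Proof. by rewrite mule_ge0 ?poweR_ge0// lee_fin invr_ge0 powR_ge0. Qed.

Lemma mdist_le_var_norm (R : realType) (E : metricType R) (r : R) (f : R -> E)
    (u v : R) : 0 < r -> u < v -> ((mdist (f u) (f v))%:E <= var_norm r f u v)%E.
Proof.
move=> r0 uv; rewrite -[leLHS](@poweRK _ _ r) ?gt_eqF ?lee_fin ?mdist_ge0//.
apply: lee_poweR; [by rewrite invr_ge0 ltW|exact: poweR_ge0|].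
exact: (partition_sup_ge1 (fun u v => (mdist (f u) (f v) `^ r)%:E)).
Qed.

Lemma V_term_le_Vtilde_term (R : realType) (E : metricType R) (delta p : R)
    (f : R -> E) (u v : R) : 0 < delta -> 0 <= p -> u < v ->
  (V_term delta p f u v <= Vtilde_term delta p f u v)%E.
Proof.
move=> d0 p0 uv; rewrite /V_term EFinM; apply: lee_wpmul2r.
  by rewrite lee_fin invr_ge0 powR_ge0.
rewrite -poweR_EFin; apply: lee_poweR => //; first by rewrite lee_fin mdist_ge0.
by apply: mdist_le_var_norm => //; rewrite invr_gt0.
Qed.

Section variation_bound.
Context {R : realType} {E : metricType R} (delta p : R) (f : R -> E) (s t : R).
Hypotheses (hd : 0 < delta) (hp : 1 < p) (hdp : p^-1 < delta) (st : s < t).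
Hypothesis fc : {within `[s, t], continuous f}.
Let M := partition_sup (N_term delta p f).
Hypothesis Mst : (M s t < +oo)%E.

Let C := embedding_const delta p.

Let C0 : 0 < C.
Proof. exact: embedding_const_gt0 _ _ _ hdp. Qed.

Let p0 : 0 < p.
Proof. exact: lt_trans ltr01 hp. Qed.

Let M0 a b : a <= b -> (0 <= M a b)%E.
Proof. by apply: partition_sup_ge0; exact: N_term_ge0. Qed.

Let Mfin a b : s <= a -> a <= b -> b <= t -> M a b \is a fin_num.
Proof.
move=> sa ab bt; rewrite ge0_fin_numE ?M0//; apply: le_lt_trans Mst.
by apply: le_partition_sup => //; exact: N_term_ge0.
Qed.

Let m a b := fine (M a b).

Let m0 a b : a <= b -> 0 <= m a b.
Proof. by move=> ab; rewrite fine_ge0 ?M0. Qed.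

Let mD a b c : s <= a -> a <= b -> b <= c -> c <= t -> m a b + m b c <= m a c.
Proof.
move=> sa ab bc ct; rewrite -lee_fin EFinD !fineK.
- exact: partition_sup_superadditive (N_term_ge0 _ _ _ _ _) _ _ _.
- by apply: Mfin => //; lra.
- by apply: Mfin => //; lra.
- by apply: Mfin => //; lra.
Qed.

Let th := (p * delta)^-1.

Let th01 : 0 < th < 1.
Proof.
rewrite invr_gt0 mulr_gt0//= invf_lt1 ?mulr_gt0//.
by move: hdp; rewrite -[_ < delta](ltr_pM2l p0) divff// gt_eqF.
Qed.

(** The bound of [mdist_le_N_norm] for [N = m a b ^ (1 / p)], raised to the
    power [1 / delta]; this power makes it superadditive. *)
Let w a b := C `^ delta^-1 * ((b - a) `^ (1 - th) * m a b `^ th).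

Let mdist_powR_le a b : s <= a -> a < b -> b <= t ->
  mdist (f a) (f b) `^ delta^-1 <= w a b.
Proof.
move=> sa ab bt; have Nm : (N_norm delta p f a b <= (m a b `^ p^-1)%:E)%E.
  rewrite -poweR_EFin fineK; last by apply: Mfin => //; exact: ltW.
  rewrite -[leLHS](@poweRK _ _ p) ?gt_eqF ?N_norm_ge0//.
  apply: lee_poweR; [by rewrite invr_ge0 ltW|exact: poweR_ge0|].
  exact: (partition_sup_ge1 (N_term delta p f)).
have p1 : 1 <= p by exact: ltW.
have := mdist_le_N_norm _ _ delta p _ f a b p1 hdp (powR_ge0 _ _) ab
  (within_itvS _ _ _ _ _ _ _ sa bt fc) Nm.
rewrite -/C => dm.
have dV0 : 0 <= delta^-1 by rewrite invr_ge0 ltW.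
apply: (le_trans (ge0_ler_powR dV0 _ _ dm)).
- by rewrite nnegrE mdist_ge0.
- by rewrite nnegrE; apply: mulr_ge0; [exact: ltW|rewrite mulr_ge0 ?powR_ge0].
rewrite (powRM _ (ltW C0)) ?mulr_ge0 ?powR_ge0// powRM ?powR_ge0//.
rewrite /w; apply: ler_wpM2l; first exact: powR_ge0.
rewrite -!powRrM -invfM -/th mulrC mulrBl -invfM -/th divff// gt_eqF//.
Qed.

Let wD a b c : s <= a -> a <= b -> b <= c -> c <= t -> w a b + w b c <= w a c.
Proof.
move=> sa ab bc ct; rewrite -mulrDr; apply: ler_wpM2l; first exact: powR_ge0.
apply: (le_trans (powR_geometric_superadditive _ _ _ _ _ _ th01 _ _ _ _));
  rewrite ?subr_ge0 ?m0//.
rewrite (_ : b - a + (c - b) = c - a); last by ring.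
apply: ler_wpM2l; first exact: powR_ge0.
apply: ge0_ler_powR; rewrite ?nnegrE ?addr_ge0 ?m0 ?mD//.
  by case/andP: th01 => /ltW.
exact: le_trans bc.
Qed.

(** The exponents match because [(1 - th) delta p = delta p - 1] and
    [th delta p = 1]. *)
Lemma Vtilde_term_le_Nhat :
  (Vtilde_term delta p f s t <= (C `^ p)%:E * partition_sup (N_term delta p f) s t)%E.
Proof.
have w0 a b : 0 <= w a b by rewrite !mulr_ge0 ?powR_ge0.
have supw : (partition_sup (fun u v => (mdist (f u) (f v) `^ delta^-1)%:E) s t
    <= (w s t)%:E)%E.
  apply: (@partition_sup_le _ _ (fun a b => (w a b)%:E)).
  - by move=> a _; rewrite lee_fin.
  - by move=> a b *; rewrite lee_fin mdist_powR_le.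
  - by move=> a b c *; rewrite -EFinD lee_fin wD.
have st0 : 0 < t - s by rewrite subr_gt0.
rewrite /Vtilde_term /var_norm invrK -poweRrM gtr0_norm//.
rewrite -/M -(fineK (Mfin _ _ (lexx s) (ltW st) (lexx t))) -/(m s t) -EFinM.
rewrite lee_pdivrMr ?powR_gt0// -EFinM.
have -> : C `^ p * m s t * (t - s) `^ (delta * p - 1) = w s t `^ (delta * p).
  rewrite /w (powRM _ (powR_ge0 _ _)) ?mulr_ge0 ?powR_ge0//.
  rewrite (powRM _ (powR_ge0 _ _) (powR_ge0 _ _)) -!powRrM.
  rewrite [delta^-1 * _]mulrA mulVf ?gt_eqF// mul1r.
  have thE : th * (delta * p) = 1.
    by rewrite /th mulrC [delta * p]mulrC divff// gt_eqF// mulr_gt0.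
  rewrite thE mulrBl thE mul1r powRr1 ?m0 ?(ltW st)//; ring.
rewrite -poweR_EFin; apply: lee_poweR => //.
  by rewrite ltW// mulr_gt0.
by apply: partition_sup_ge0 => *; [rewrite lee_fin powR_ge0|exact: ltW].
Qed.

End variation_bound.

(** * Equivalence of the norms *)

Theorem theorem2p11 (R : realType) (E : metricType R) (T delta p : R)
    (hT : 0 < T) (hdelta : 0 < delta < 1) (hp : 1 < p) (hdp : p^-1 < delta) :
  (exists C1 C2 C3 : R, [/\ 0 < C1, 0 < C2, 0 < C3 &
    forall f : R -> E, {within `[0, T], continuous f} ->
      [/\ (V_norm delta p f 0 T <= C1%:E * Vtilde_norm delta p f 0 T)%E,
          (Vtilde_norm delta p f 0 T <= C2%:E * Nhat_norm delta p f 0 T)%E &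
          (Nhat_norm delta p f 0 T <= C3%:E * V_norm delta p f 0 T)%E]]) /\
  (V_space E delta p T = Vtilde_space E delta p T /\
   Vtilde_space E delta p T = Nhat_space E delta p T).
Proof.
have p0 : 0 < p by lra.
have [d0 _] := andP hdelta.
set C := embedding_const delta p.
have C0 : 0 < C by exact: embedding_const_gt0 _ _ _ hdp.
have main (f : R -> E) : {within `[0, T], continuous f} ->
      [/\ (V_norm delta p f 0 T <= 1%:E * Vtilde_norm delta p f 0 T)%E,
          (Vtilde_norm delta p f 0 T <= C%:E * Nhat_norm delta p f 0 T)%E &
          (Nhat_norm delta p f 0 T <= 1%:E * V_norm delta p f 0 T)%E].
  move=> fc; have T0 := ltW hT; split.
  - apply: (partition_sup_poweR_le _ (V_term delta p f) (Vtilde_term delta p f)) => //.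
    + exact: V_term_ge0.
    + exact: Vtilde_term_ge0.
    move=> u v _ uv _; rewrite powR1 mul1e.
    apply: le_trans (partition_sup_ge1 _ _ _ uv).
    by apply: V_term_le_Vtilde_term => //; exact: ltW.
  - have [->|Nfin] := eqVneq (Nhat_norm delta p f 0 T) +oo%E.
      by rewrite gt0_muley ?lte_fin// leey.
    apply: (partition_sup_poweR_le _ (Vtilde_term delta p f) (N_term delta p f)) => //.
    + exact: Vtilde_term_ge0.
    + exact: N_term_ge0.
    move=> u v u0 uv vT; apply: Vtilde_term_le_Nhat => //.
      exact: within_itvS u0 vT fc.
    apply: (@le_lt_trans _ _ (partition_sup (N_term delta p f) 0 T)).
      by apply: le_partition_sup => //; [exact: N_term_ge0|exact: ltW].
    rewrite ltey; apply: contra Nfin => /eqP NT.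
    by apply/eqP/eqy_poweR => //; rewrite invr_gt0.
  - apply: (partition_sup_poweR_le _ (N_term delta p f) (V_term delta p f)) => //.
    + exact: N_term_ge0.
    + exact: V_term_ge0.
    move=> u v u0 uv vT; rewrite powR1 mul1e.
    by apply: N_norm_poweR_le => //; exact: within_itvS u0 vT fc.
split; first by exists 1, C, 1; split.
have fin (c : R) (x : \bar R) : 0 <= c -> (x < +oo)%E -> (c%:E * x < +oo)%E.
  by move=> c0 xy; apply: lte_mul_pinfty => //; rewrite lee_fin.
split; apply/seteqP; split => f [fc ffin]; split=> //; have [h1 h2 h3] := main f fc.
- by apply: (le_lt_trans h2 (fin _ _ (ltW C0) (le_lt_trans h3 (fin _ _ ler01 _)))).
- exact: (le_lt_trans h1 (fin _ _ ler01 _)).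
- exact: (le_lt_trans h3 (fin _ _ ler01 (le_lt_trans h1 (fin _ _ ler01 _)))).
- exact: (le_lt_trans h2 (fin _ _ (ltW C0) _)).
Qed.
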